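(* Let $a<b$ be real and $c=(a+b)/2$. Let $\beta_\infty=\sqrt2$ and $\alpha_\infty=(b-a)/(2\sqrt2)$. Amongst all monic quadratic polynomials $\phi$ with real coefficients, $\phi(x)=(x-c)^2-\alpha_\infty^2$ is the unique minimizer of the optimal error constant $K_1(\phi)$ (defined in the context). This choice gives, for every $f:[a,b]\to\mathbb{R}$ such that $f'$ is absolutely continuous on $[a,b]$ (so $f''\in L^1([a,b])$), the quadrature formula $$\int_a^b f(x)\,dx=\frac{b-a}{2}\left[f(a)+f(b)\right]+\frac{(b-a)^2}{16}\left[f'(a)-f'(b)\right]+E(f),$$ where $|E(f)|\le \|f''\|_1(b-a)^2/16$, and this error estimate is optimal: the coefficient $(b-a)^2/16$ of $\|f''\|_1$ cannot be replaced by any smaller constant valid for all such $f$.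
   Context: $\|\cdot\|_1$ is the $L^1([a,b])$ norm. For a monic quadratic polynomial $\phi$ with real coefficients and $f$ with $f'$ absolutely continuous on $[a,b]$, define $E_\phi(f)$ by $$\int_a^b f(x)\,dx=\tfrac12\left[-f(a)\phi'(a)+f(b)\phi'(b)+f'(a)\phi(a)-f'(b)\phi(b)\right]+E_\phi(f);$$ integration by parts gives $E_\phi(f)=\tfrac12\int_a^b f''(x)\phi(x)\,dx$. The optimal error constant is $$K_1(\phi)=\sup\{|E_\phi(f)| : f' \text{ absolutely continuous on } [a,b],\ \|f''\|_1\le 1\}.$$ In the quadrature formula, $E(f)=E_\phi(f)$ for the stated $\phi$. *)

(* Defs.v *)
From HB Require Import structures.
From mathcomp Require Import all_boot all_order all_algebra.
From mathcomp Require Import all_classical all_reals all_analysis.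

Set Implicit Arguments.
Unset Strict Implicit.
Unset Printing Implicit Defensive.

Import Order.TTheory GRing.Theory Num.Theory.
Import numFieldNormedType.Exports.

Local Open Scope classical_set_scope.
Local Open Scope ring_scope.

(* A function on [a, b] is represented by a total function R -> R. Everything
   below depends only on its values on `[a, b]: derivatives are limits taken
   within `[a, b], hence one-sided at a and at b, unlike those of f^`(). *)

Definition slope_in (R : realType) (f : R -> R) (x y : R) : R :=
  (f y - f x) / (y - x).

Definition derivable_in (R : realType) (a b : R) (f : R -> R) (x : R) : Prop :=
  cvg (slope_in f x y @[y --> within `[a, b]%classic x^']).

(* As lim is total, derive_in a b f x is an arbitrary default value at the
   points where f is not derivable. *)
Definition derive_in (R : realType) (a b : R) (f : R -> R) (x : R) : R :=
  lim (slope_in f x y @[y --> within `[a, b]%classic x^']).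

Definition abs_continuous (R : realType) (a b : R) (g : R -> R) : Prop :=
  forall e : R, 0 < e -> exists2 d : R, 0 < d &
    forall (n : nat) (s t : 'I_n -> R),
      (forall i, [/\ a <= s i, s i < t i & t i <= b]) ->
      trivIset [set: 'I_n] (fun i => `]s i, t i[%classic) ->
      \sum_(i < n) (t i - s i) < d ->
      \sum_(i < n) `|g (t i) - g (s i)| < e.

Definition derivative_AC (R : realType) (a b : R) (f : R -> R) : Prop :=
  (forall x, x \in `[a, b] -> derivable_in a b f x) /\
  abs_continuous a b (derive_in a b f).

Definition derive2_in (R : realType) (a b : R) (f : R -> R) : R -> R :=
  derive_in a b (derive_in a b f).

Definition norm1 (R : realType) (a b : R) (g : R -> R) : \bar R :=
  'N[@lebesgue_measure R]_1 [(EFin \o g) \_ `[a, b]%classic].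

Definition monic_quadratic (R : realType) (phi : {poly R}) : Prop :=
  phi \is monic /\ size phi = 3%N.

Definition quad_error (R : realType) (a b : R) (phi : {poly R}) (f : R -> R)
    : R :=
  \int[@lebesgue_measure R]_(x in `[a, b]) f x
  - 2^-1 * (- (f a * (phi^`()).[a]) + f b * (phi^`()).[b]
            + derive_in a b f a * phi.[a] - derive_in a b f b * phi.[b]).

Definition K1 (R : realType) (a b : R) (phi : {poly R}) : \bar R :=
  ereal_sup [set (`|quad_error a b phi f|)%:E | f in
    [set f : R -> R |
      derivative_AC a b f /\ (norm1 a b (derive2_in a b f) <= 1)%E]].

Definition minimizes_K1 (R : realType) (a b : R) (phi : {poly R}) : Prop :=
  monic_quadratic phi /\
  forall psi : {poly R}, monic_quadratic psi -> (K1 a b phi <= K1 a b psi)%E.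

(* Main.v *)
(* An absolutely continuous g is the difference of its total variation and of
   another nondecreasing absolutely continuous function; the Stieltjes measures
   of both are dominated by the Lebesgue measure, so the Radon-Nikodym and
   Lebesgue differentiation theorems give \int_a^b g' = g(b) - g(a).  Integration
   by parts then yields E_psi(f) = 1/2 \int_a^b f'' psi, hence
   |E_psi(f)| <= ||f''||_1 sup|psi| / 2, and letting f'' concentrate near a point x
   shows that K_1(psi) >= |psi(x)| / 2.  So minimizing K_1 is Chebyshev's problem
   for monic quadratics: with c = (a + b) / 2, the identity
   psi(a) - 2 psi(c) + psi(b) = (b - a)^2 / 2 forces sup|psi| >= (b - a)^2 / 8,
   with equality only for psi = (X - c)^2 - (b - a)^2 / 8. *)

Require Import Defs.
From HB Require Import structures.
From mathcomp Require Import all_boot all_order all_algebra.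
From mathcomp Require Import all_classical all_reals all_analysis.
From mathcomp Require Import measurable_realfun ring lra.

Set Implicit Arguments.
Unset Strict Implicit.
Unset Printing Implicit Defensive.

Import Order.TTheory GRing.Theory Num.Theory.
Import numFieldNormedType.Exports.

Local Open Scope classical_set_scope.
Local Open Scope ring_scope.

(** * Absolute continuity and total variation *)

Section absolute_continuity.
Context {R : realType}.
Implicit Types (a b : R) (g h : R -> R).

Lemma abs_continuous_fin a b g : abs_continuous a b g ->
  forall e : R, 0 < e -> exists2 d : R, 0 < d &
    forall (I : finType) (s t : I -> R),
      (forall i, [/\ a <= s i, s i <= t i & t i <= b]) ->
      trivIset [set: I] (fun i => `]s i, t i[%classic) ->
      \sum_i (t i - s i) < d ->
      \sum_i `|g (t i) - g (s i)| < e.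
Proof.
move=> gAC e e0; have [d d0 gd] := gAC e e0; exists d => // I s t st dst std.
pose A := [pred i | s i < t i].
have drop (F : R -> R) : \sum_i `|F (t i) - F (s i)| =
    \sum_(k < #|A|) `|F (t (enum_val k)) - F (s (enum_val k))|.
  rewrite (bigID A)/= [X in _ + X]big1 ?addr0; last first.
    move=> i; rewrite -leNgt => tsi; have [_ sti _] := st i.
    suff -> : s i = t i by rewrite subrr normr0.
    by apply/le_anti/andP.
  by rewrite (big_enum_val (A := A) (fun i => `|F (t i) - F (s i)|)).
rewrite (drop g); apply: gd.
- move=> k; have [asi _ tbi] := st (enum_val k); split => //.
  by have := enum_valP k; rewrite inE.
- move=> k l _ _ kl; apply: enum_val_inj; exact: dst.
- apply: le_lt_trans std.
  rewrite [leRHS](eq_bigr (fun i => `|id (t i) - id (s i)|)).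
    by rewrite (drop id); apply: ler_sum => k _; exact: ler_norm.
  by move=> i _; rewrite ger0_norm// subr_ge0; have [] := st i.
Qed.

(** Stability criterion from which Lipschitz functions, differences, products and polynomials are
    all obtained. *)
Lemma abs_continuous_le2 a b g h k (M N : R) :
  abs_continuous a b g -> abs_continuous a b h -> 0 <= M -> 0 <= N ->
  (forall x y, a <= x -> x <= y -> y <= b ->
    `|k y - k x| <= M * `|g y - g x| + N * `|h y - h x|) ->
  abs_continuous a b k.
Proof.
move=> gAC hAC M0 N0 kgh e e0.
(* [M] and [N] may vanish, so the divisors are [M + 1] and [N + 1]. *)
have [dg dg0 gd] := gAC (e / 2 / (M + 1)) ltac:(by rewrite !divr_gt0// ltr_wpDl).
have [dh dh0 hd] := hAC (e / 2 / (N + 1)) ltac:(by rewrite !divr_gt0// ltr_wpDl).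
exists (Num.min dg dh) => [|n s t st dst]; first by rewrite lt_min dg0.
rewrite lt_min => /andP[/(gd _ _ _ st dst) {}gd /(hd _ _ _ st dst) {}hd].
apply: le_lt_trans (_ : _ <= M * \sum_(i < n) `|g (t i) - g (s i)| +
    N * \sum_(i < n) `|h (t i) - h (s i)|) _.
  rewrite !mulr_sumr -big_split/=; apply: ler_sum => i _.
  by have [? /ltW ? ?] := st i; exact: kgh.
rewrite [ltRHS]splitr; apply: ltr_leD.
  apply: le_lt_trans (_ : _ <= (M + 1) * \sum_(i < n) `|g (t i) - g (s i)|) _.
    by rewrite ler_wpM2r ?sumr_ge0// lerDl.
  by rewrite mulrC -ltr_pdivlMr// ltr_wpDl.
apply: le_trans (_ : _ <= (N + 1) * \sum_(i < n) `|h (t i) - h (s i)|) _.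
  by rewrite ler_wpM2r ?sumr_ge0// lerDl.
by rewrite mulrC -ler_pdivlMr ?ltW// ltr_wpDl.
Qed.

Lemma abs_continuous_id a b : abs_continuous a b id.
Proof.
move=> e e0; exists e => // n s t st _.
rewrite (eq_bigr (fun i => `|id (t i) - id (s i)|)) => [//|i _].
by have [_ ? _] := st i; rewrite /= ger0_norm// subr_ge0 ltW.
Qed.

Lemma abs_continuous_lipschitz a b g (M : R) : 0 <= M ->
  (forall x y, a <= x -> x <= y -> y <= b -> `|g y - g x| <= M * (y - x)) ->
  abs_continuous a b g.
Proof.
move=> M0 gM; apply: (abs_continuous_le2 (abs_continuous_id a b)
  (abs_continuous_id a b) M0 (lexx 0)) => x y ax xy yb.
by rewrite mul0r addr0 /= [`|y - x|]ger0_norm ?subr_ge0//; exact: gM.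
Qed.

Lemma abs_continuousB a b g h : abs_continuous a b g -> abs_continuous a b h ->
  abs_continuous a b (g \- h).
Proof.
move=> gAC hAC; apply: (abs_continuous_le2 gAC hAC ler01 ler01) => x y _ _ _.
have -> : (g \- h) y - (g \- h) x = (g y - g x) - (h y - h x) by rewrite /=; ring.
by rewrite !mul1r ler_normB.
Qed.

Lemma abs_continuous_dist a b g : abs_continuous a b g ->
  forall e : R, 0 < e -> exists2 d : R, 0 < d &
    forall x y, a <= x -> x <= y -> y <= b -> y - x < d -> `|g y - g x| < e.
Proof.
move=> /abs_continuous_fin gAC e /gAC[d d0 gd]; exists d => // x y ax xy yb xyd.
have := gd _ (fun=> x : R) (fun=> y) (fun _ : unit => And3 ax xy yb).
rewrite !big_const !card_unit/= !addr0; apply => //.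
by apply/trivIsetP => -[] [].
Qed.

Lemma abs_continuous_within a b g : abs_continuous a b g ->
  {within `[a, b], continuous g}.
Proof.
move=> gAC; apply/subspace_continuousP => x /=; rewrite in_itv/= => /andP[ax xb].
apply/cvgrPdist_lt => e e0; have [d d0 gd] := abs_continuous_dist gAC e0.
rewrite near_withinE; near=> y; rewrite /= in_itv/= => /andP[ay yb].
have xyd : `|x - y| < d by near: y; exact: cvgr_dist_lt.
have [xy|/ltW yx] := leP x y.
  by rewrite distrC; apply: gd => //; rewrite (le_lt_trans _ xyd)// distrC ler_norm.
by apply: gd => //; rewrite (le_lt_trans _ xyd)// ler_norm.
Unshelve. all: by end_near. Qed.

(* The intervals of all the partitions together form one finite disjoint family
   with the same total length. *)
Lemma abs_continuous_variation a b g : abs_continuous a b g ->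
  forall e : R, 0 < e -> exists2 d : R, 0 < d &
    forall (n : nat) (s t : 'I_n -> R) (l : 'I_n -> seq R),
      (forall i, [/\ a <= s i, s i < t i & t i <= b]) ->
      trivIset [set: 'I_n] (fun i => `]s i, t i[%classic) ->
      \sum_(i < n) (t i - s i) < d ->
      (forall i, itv_partition (s i) (t i) (l i)) ->
      \sum_(i < n) variation (s i) (t i) g (l i) < e.
Proof.
move=> /abs_continuous_fin gAC e /gAC[d d0 gd]; exists d => // n s t l st dst std lst.
pose I : finType := {i : 'I_n & 'I_(size (l i))}.
pose N (i : 'I_n) k := nth (t i) (s i :: l i) k.
pose S (p : I) := N (tag p) (tagged p); pose T (p : I) := N (tag p) (tagged p).+1.
have flat (F : R -> R) : \sum_(i < n) \sum_(0 <= k < size (l i))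
    (F (N i k.+1) - F (N i k)) = \sum_p (F (T p) - F (S p)).
  under eq_bigr do rewrite big_mkord.
  by rewrite (sig_big_dep (fun=> true) (fun _ _ => true)
    (fun i (k : 'I_(size (l i))) => F (N i k.+1) - F (N i k))).
have flatn : \sum_(i < n) variation (s i) (t i) g (l i) =
    \sum_p `|g (T p) - g (S p)|.
  rewrite /variation; under eq_bigr do rewrite big_mkord.
  by rewrite (sig_big_dep (fun=> true) (fun _ _ => true)
    (fun i (k : 'I_(size (l i))) => `|g (N i k.+1) - g (N i k)|)).
have N_lt i j k : (j < k)%N -> (k <= size (l i))%N -> N i j < N i k.
  move=> jk kl; have [sl _] := lst i.
  rewrite /N (@lt_sorted_ltn_nth _ _ (t i) (s i :: l i) sl)//.
  by rewrite inE/= ltnS (leq_trans (ltnW jk)).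
have N_le i j k : (j <= k)%N -> (k <= size (l i))%N -> N i j <= N i k.
  by rewrite leq_eqVlt => /predU1P[->//|jk kl]; exact/ltW/N_lt.
have sN i k : (k <= size (l i))%N -> s i <= N i k by move=> kl; exact: (N_le i 0).
have Nt i k : (k <= size (l i))%N -> N i k <= t i.
  move=> kl; rewrite (le_trans (N_le _ _ _ kl _))//.
  by rewrite /N (itv_partition_nth_size _ (lst i)).
rewrite flatn; apply: gd.
- move=> [i k]; have [asi _ tbi] := st i; have kl := ltn_ord k; split.
  + exact/(le_trans asi)/sN/ltnW.
  + by apply: N_le.
  + exact/(le_trans _ tbi)/Nt.
- move=> [i j] [i' j'] _ _ [x []] /=; rewrite /S /T/= !in_itv/=.
  move=> /andP[jx xj] /andP[j'x xj'].
  (* Cells that meet lie in intervals that meet, hence in the same interval; there the increasing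
     order of the nodes forces equal indices. *)
  have ii' : i = i'.
    apply: dst => //; exists x; split; rewrite /= in_itv/=.
      by rewrite (le_lt_trans _ jx) ?(lt_le_trans xj)// ?Nt ?sN// ltnW.
    by rewrite (le_lt_trans _ j'x) ?(lt_le_trans xj')// ?Nt ?sN// ltnW.
  subst i'; congr existT; apply/val_inj/eqP; rewrite eqn_leq/=.
  apply/andP; split; rewrite leqNgt; apply/negP => jj'.
    have := N_le i _ _ jj' (ltnW (ltn_ord j)).
    by rewrite leNgt (lt_trans jx xj').
  have := N_le i _ _ jj' (ltnW (ltn_ord j')).
  by rewrite leNgt (lt_trans j'x xj).
- rewrite -(flat id); apply: le_lt_trans std; apply: ler_sum => i _.
  by rewrite telescope_sumr// /N (itv_partition_nth_size _ (lst i)).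
Qed.

(** If [d] answers to the tolerance 1, the variation over any interval shorter than [d] is at most
    1, and finitely many such intervals cover [[a, b]]. *)
Lemma abs_continuous_bounded_variation a b g : a <= b ->
  abs_continuous a b g -> bounded_variation a b g.
Proof.
move=> ab gAC; have [d d0 gd] := abs_continuous_variation gAC ltr01.
have small x y : a <= x -> x < y -> y <= b -> y - x < d ->
    total_variation x y g \is a fin_num.
  move=> ax xy yb xyd; apply/bounded_variationP; first exact: ltW.
  exists 1 => _ [l lxy <-]; apply: ltW.
  have := gd 1%N (fun=> x) (fun=> y) (fun=> l) (fun=> And3 ax xy yb).
  rewrite !big_ord1; apply => //.
  by apply/trivIsetP => i j _ _; rewrite !ord1 eqxx.
(* The induction cuts off a last piece of length [d / 2], strictly shorter than [d] as [small]
   demands. *)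
have steps n : forall x, a <= x -> x <= b -> x - a < n%:R * (d / 2) ->
    total_variation a x g \is a fin_num.
  elim: n => [x ax _|n ih x ax xb xn].
    by rewrite mul0r subr_lt0 ltNge ax.
  have [xd|dx] := ltP (x - a) d.
    move: ax; rewrite le_eqVlt => /predU1P[<-|ax]; last exact: small.
    by rewrite total_variationxx.
  have ax' : a <= x - d / 2 by lra.
  have x'x : x - d / 2 <= x by lra.
  rewrite (total_variationD g ax' x'x) fin_numD; apply/andP; split.
    apply: ih => //; first lra.
    by move: xn; rewrite -natr1 mulrDl mul1r; lra.
  by apply: small => //; lra.
apply/bounded_variationP => //.
apply: (steps (Num.bound ((b - a) / (d / 2)))) => //.
rewrite -ltr_pdivrMr ?divr_gt0//; apply: archi_boundP.
by rewrite !divr_ge0 ?subr_ge0// ltW.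
Qed.

(** The increment of the total variation over an interval is nearly the variation along a
    well-chosen partition, and [abs_continuous_variation] controls the sum of the latter. *)
Lemma abs_continuous_total_variation a b g : a <= b -> abs_continuous a b g ->
  abs_continuous a b (fine \o total_variation a ^~ g).
Proof.
move=> ab gAC e e0; have gBV := abs_continuous_bounded_variation ab gAC.
have fin x y : a <= x -> x <= y -> y <= b ->
    total_variation x y g \is a fin_num.
  move=> ax xy yb; apply/bounded_variationP => //.
  exact/(bounded_variationl xy yb)/(bounded_variationr ax (le_trans xy yb)).
have e20 : 0 < e / 2 by rewrite divr_gt0.
have [d d0 gd] := abs_continuous_variation gAC e20.
exists d => // n s t st dst std.
(* The [n] slacks together cost at most [e / 2]; the successor keeps the divisor positive when the
   family is empty. *)
pose eps : R := e / 2 / n.+1%:R.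
have eps0 : 0 < eps by rewrite divr_gt0.
have approx i : exists2 l, itv_partition (s i) (t i) l &
    (total_variation (s i) (t i) g - eps%:E < (variation (s i) (t i) g l)%:E)%E.
  have [asi sti tbi] := st i.
  have [_ [_ [l lst <-] <-] tvl] := ub_ereal_sup_adherent eps0 (fin _ _ asi (ltW sti) tbi).
  by exists l.
pose l i := s2val (cid2 (approx i)).
have lst i : itv_partition (s i) (t i) (l i) by rewrite /l; case: cid2.
have ltv i : (total_variation (s i) (t i) g - eps%:E <
    (variation (s i) (t i) g (l i))%:E)%E by rewrite /l; case: cid2.
have {}gd := gd _ _ _ _ st dst std lst.
apply: le_lt_trans (_ : _ <= \sum_(i < n) (variation (s i) (t i) g (l i) + eps)) _.
  apply: ler_sum => i _; have [asi /ltW sti tbi] := st i.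
  rewrite /= (total_variationD g asi sti) fineD ?fin//; last exact: le_trans sti tbi.
  rewrite addrAC subrr add0r ger0_norm ?fine_ge0 ?total_variation_ge0//.
  rewrite -lerBlDr -lee_fin EFinB fineK ?fin//; exact/ltW/ltv.
rewrite big_split/= sumr_const card_ord [ltRHS]splitr; apply: ltr_leD => //.
rewrite -[leLHS]mulr_natr /eps -mulrA ler_piMr ?(ltW e20)//.
by rewrite [_^-1 * _]mulrC ler_pdivrMr// mul1r ler_nat.
Qed.

End absolute_continuity.

(** * Densities of nondecreasing absolutely continuous functions *)

Section density.
Context {R : realType}.
Implicit Types (a b : R) (g h : R -> R).
Notation mu := (@lebesgue_measure R).

(** For [a <= b] this is the retraction of the line onto [[a, b]]. Composing with it extends a
    function on the segment by constants, which preserves continuity and monotonicity, so that a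
    Stieltjes measure can be formed. *)
Definition clamp a b (x : R) : R := Num.max a (Num.min b x).

Lemma clamp_id a b x : a <= x -> x <= b -> clamp a b x = x.
Proof. by move=> ax xb; rewrite /clamp min_r// max_r. Qed.

Lemma clamp_ge a b x : a <= clamp a b x.
Proof. by rewrite le_max lexx. Qed.

Lemma clamp_le a b x : a <= b -> clamp a b x <= b.
Proof. by move=> ab; rewrite ge_max ab ge_min lexx. Qed.

Lemma le_clamp a b x y : x <= y -> clamp a b x <= clamp a b y.
Proof.
move=> xy; rewrite /clamp ge_max le_max lexx/= le_max; apply/orP; right.
by rewrite le_min !ge_min lexx xy orbT.
Qed.

Lemma clamp_dist a b x y : x <= y -> clamp a b y - clamp a b x <= y - x.
Proof.
by move=> xy; rewrite /clamp /Num.max /Num.min; repeat case: ifPn; rewrite -?leNgt; lra.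
Qed.

Lemma abs_continuous_clamp a b g : a <= b -> abs_continuous a b g ->
  continuous (g \o clamp a b).
Proof.
move=> ab gAC x; apply/cvgrPdist_lt => e e0.
have [d d0 gd] := abs_continuous_dist gAC e0; near=> y => /=.
have xyd : `|x - y| < d by near: y; exact: cvgr_dist_lt.
have [xy|/ltW yx] := leP x y.
  rewrite distrC; apply: gd; rewrite ?clamp_ge ?clamp_le ?le_clamp//.
  by rewrite (le_lt_trans (clamp_dist _ _ xy))// (le_lt_trans _ xyd)// distrC ler_norm.
apply: gd; rewrite ?clamp_ge ?clamp_le ?le_clamp//.
by rewrite (le_lt_trans (clamp_dist _ _ yx))// (le_lt_trans _ xyd)// ler_norm.
Unshelve. all: by end_near. Qed.

Lemma open_bounded_interval (I : set R) : open I -> is_interval I ->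
  has_lbound I -> has_ubound I -> I !=set0 ->
  I = `]inf I, sup I[%classic /\ inf I < sup I.
Proof.
move=> oI iI lI uI [x Ix]; have E : I = `]inf I, sup I[%classic.
  rewrite -{1}((interior_id I).1 oI) interval_bounded_interior//.
split=> //; move: Ix; rewrite {1}E/= in_itv/= => /andP[]; exact: lt_trans.
Qed.

Lemma lebesgue_stieltjes_measure_oc (H : cumulative R R) x y : x <= y ->
  lebesgue_stieltjes_measure H `]x, y]%classic = (H y - H x)%:E.
Proof.
move=> xy; rewrite /lebesgue_stieltjes_measure /measure_extension.
by rewrite measurable_mu_extE/= ?wlength_itv_bnd//; exact: is_ocitv.
Qed.

(** [U] is a countable disjoint union of open intervals. Any finitely many of them have total length
    below [d], hence increments of [H] summing to less than [e]; the bound passes to the limit of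
    the partial sums. *)
Lemma lebesgue_stieltjes_measure_open (H : cumulative R R) a b (e d : R) : a <= b ->
  (forall (I : finType) (s t : I -> R),
      (forall i, [/\ a <= s i, s i <= t i & t i <= b]) ->
      trivIset [set: I] (fun i => `]s i, t i[%classic) ->
      \sum_i (t i - s i) < d ->
      \sum_i `|H (t i) - H (s i)| < e) ->
  forall U : set R, open U -> U `<=` `]a, b[ -> (mu U < d%:E)%E ->
  (lebesgue_stieltjes_measure H U <= e%:E)%E.
Proof.
move=> ab HAC U oU Uab Ud.
pose I := open_disjoint_itv oU.
have UE : U = \bigcup_i I i := open_disjoint_itv_bigcup oU.
have oI i : open (I i) by exact: open_disjoint_itv_open.
have dI : trivIset [set: nat] I by exact: open_disjoint_itv_trivIset.
have mI i : measurable (I i : set (measurableTypeR R)) by exact: open_measurable.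
have Iab i : I i `<=` `]a, b[ by move=> x Ix; apply: Uab; rewrite UE; exists i.
have iI i : is_interval (I i) by exact: open_disjoint_itv_is_interval.
(* An empty component is represented by the degenerate interval []a, a[]. *)
pose s i := if pselect (I i !=set0) then inf (I i) else a.
pose t i := if pselect (I i !=set0) then sup (I i) else a.
have Ist i : [/\ a <= s i, s i <= t i, t i <= b & I i = `]s i, t i[%classic].
  rewrite /s /t; case: pselect => [I0|I0] /=; last first.
    move/set0P/negP/negPn/eqP : I0 => ->.
    by rewrite set_itv_ge ?bnd_simp ?ltxx// lexx.
  have lI : has_lbound (I i).
    by exists a => x /Iab/=; rewrite in_itv/= => /andP[/ltW].
  have uI : has_ubound (I i).
    by exists b => x /Iab/=; rewrite in_itv/= => /andP[_ /ltW].
  have [IE] := open_bounded_interval (oI i) (iI i) lI uI I0.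
  move=> /ltW st; split => //.
  + apply: lb_le_inf => // x /Iab/=; rewrite in_itv/= => /andP[/ltW//].
  + apply: ge_sup => // x /Iab/=; rewrite in_itv/= => /andP[_ /ltW//].
have mU : measurable (\bigcup_i I i : set (measurableTypeR R)).
  exact: bigcup_measurable.
rewrite {1}UE measure_semi_bigcup//.
apply: lime_le; first exact: is_cvg_nneseries.
apply: nearW => n; rewrite big_mkord.
apply: (@le_trans _ _ (\sum_(i < n) (H (t i) - H (s i)))%:E).
  rewrite -sumEFin; apply: lee_sum => i _; have [_ st _ IE] := Ist i.
  rewrite -lebesgue_stieltjes_measure_oc// IE le_measure ?inE//.
  by apply: subset_itvl; rewrite bnd_simp.
rewrite lee_fin ltW//; apply: le_lt_trans (_ : _ <= \sum_(i < n) `|H (t i) - H (s i)|) _.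
  by apply: ler_sum => i _; exact: ler_norm.
apply: HAC.
- by move=> i; have [] := Ist i.
- move=> i j _ _ /=; have [_ _ _ <-] := Ist i; have [_ _ _ <-] := Ist j.
  by move=> ij; apply: val_inj; exact: dI.
- rewrite -lte_fin; apply: le_lt_trans Ud; rewrite -sumEFin.
  rewrite [leLHS](eq_bigr (fun i : 'I_n => mu (I i))); last first.
    move=> i _; have [_ st _ ->] := Ist i.
    rewrite lebesgue_measure_itv/= lte_fin; case: ltP => // ts.
    by congr EFin; apply/eqP; rewrite subr_eq0 eq_le ts.
  rewrite UE measure_semi_bigcup// -(big_mkord xpredT (fun i => mu (I i))).
  by apply: nneseries_lim_ge.
Qed.


(** [r] is the Radon-Nikodym derivative of the Stieltjes measure of the clamped [h], restricted to
    []a, b]] to make it finite. *)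
Lemma nondecreasing_abs_continuous_density a b h : a <= b ->
  {in `[a, b] &, nondecreasing_fun h} -> abs_continuous a b h ->
  exists r : R -> R, mu.-integrable [set: R] (EFin \o r) /\
    forall x, a <= x -> x <= b -> h x - h a = \int[mu]_(t in `[a, x]) r t.
Proof.
move=> ab hnd hAC.
have Hnd : nondecreasing (h \o clamp a b).
  by move=> x y xy; apply: hnd; rewrite ?in_itv/= ?clamp_ge ?clamp_le ?le_clamp.
have Hrc : right_continuous (h \o clamp a b).
  exact/right_continuousW/abs_continuous_clamp.
pose H : cumulative R R := HB.pack (h \o clamp a b)
  (isCumulative.Build R _ R (h \o clamp a b) Hnd Hrc).
have HE x : a <= x -> x <= b -> H x = h x by move=> ax xb; rewrite /H/= clamp_id.
have mD : measurable (`]a, b]%classic : set (measurableTypeR R)) by [].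
have Doo : (lebesgue_stieltjes_measure H `]a, b]%classic < +oo)%E.
  by rewrite lebesgue_stieltjes_measure_oc// ltry.
pose nu : {finite_measure set (measurableTypeR R) -> \bar R} := mfrestr mD Doo.
have nuE A : nu A = lebesgue_stieltjes_measure H (A `&` `]a, b]%classic) by [].
have nu_oc x : a <= x -> x <= b -> nu `]a, x]%classic = (h x - h a)%:E.
  move=> ax xb; rewrite nuE -(HE x)// -(HE a)// -lebesgue_stieltjes_measure_oc//.
  by congr (lebesgue_stieltjes_measure H _); rewrite setIidl//; exact: subset_itvl.
(* The estimate on open sets only covers []a, b[]. The endpoint [b] carries no mass because it lies
   in []y, b]], whose mass [h b - h y] is small for [y] close to [b]. *)
have Hb0 : (lebesgue_stieltjes_measure H (`]a, b] `&` [set b])%classic = 0)%E.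
  move: ab; rewrite le_eqVlt => /predU1P[<-|ab].
    by rewrite set_itv_ge ?bnd_simp ?ltxx// set0I measure0.
  apply/eqP; rewrite eq_le measure_ge0 andbT; apply/lee_addgt0Pr => e e0.
  rewrite add0e; have [d d0 hd] := abs_continuous_dist hAC e0.
  pose y := Num.max a (b - d / 2).
  have ay : a <= y by rewrite le_max lexx.
  have yb : y < b by rewrite gt_max ab; lra.
  apply: (@le_trans _ _ (lebesgue_stieltjes_measure H `]y, b]%classic)).
    apply: le_measure; rewrite ?inE//; first exact: measurableI.
    by move=> z [_ /= ->]; rewrite in_itv/= yb lexx.
  rewrite lebesgue_stieltjes_measure_oc ?(ltW yb)// lee_fin !HE ?(ltW yb) ?(ltW ab)//.
  rewrite (le_trans (ler_norm _))// ltW// hd// ?(ltW yb)//.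
  have : b - d / 2 <= y by rewrite le_max lexx orbT.
  by lra.
(* By outer regularity a null set sits in an open set of Lebesgue measure below [d], whose trace on
   []a, b[] has Stieltjes measure at most [e]. *)
have nu_mu : nu `<< mu.
  apply/null_content_dominatesP => N mN N0; apply/eqP.
  rewrite eq_le measure_ge0 andbT; apply/lee_addgt0Pr => e e0; rewrite add0e.
  have [d d0 hd] := abs_continuous_fin hAC e0.
  have [|U [oU NU Ud]] := lebesgue_regularity_outer mN _ d0; first by rewrite N0.
  have mU : measurable (U : set (measurableTypeR R)) by exact: open_measurable.
  have {}Ud : (mu U < d%:E)%E.
    by rewrite -(setDUK NU) measureU// ?N0 ?add0e ?setDIK//; exact: measurableD.
  pose V := U `&` `]a, b[.
  have oV : open V by apply: openI => //; exact: interval_open.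
  have mV : measurable (V : set (measurableTypeR R)) by exact: open_measurable.
  have Vd : (mu V < d%:E)%E.
    by apply: le_lt_trans Ud; rewrite le_measure ?inE//; exact: subIsetl.
  have VE : (lebesgue_stieltjes_measure H V <= e%:E)%E.
    apply: (lebesgue_stieltjes_measure_open ab _ oV _ Vd); last exact: subIsetr.
    move=> I s t st dst std; have := hd I s t st dst std.
    rewrite (eq_bigr (fun i => `|H (t i) - H (s i)|))// => i _.
    by have [ai si bi] := st i; rewrite !HE ?(le_trans ai si) ?(le_trans si bi).
  rewrite nuE -[leRHS]adde0 -Hb0.
  apply: (@le_trans _ _ (lebesgue_stieltjes_measure H (V `|` (`]a, b] `&` [set b])))).
    apply: le_measure; rewrite ?inE//; [exact: measurableI| |].
      by apply: measurableU => //; exact: measurableI.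
    move=> x [Nx]; rewrite /= in_itv/= => /andP[ax].
    rewrite le_eqVlt => /predU1P[xb|xb]; [right|left].
      by split; [rewrite /= ax xb eqxx|exact: xb].
    by split; [exact: NU|rewrite /= in_itv/= ax].
  apply: (le_trans (measureU2 _ _ _)) => //; first exact: measurableI.
  exact: leeD2r.
have [r [r0 rfin rint rE]] := radon_nikodym_sigma_finite nu_mu.
exists (fine \o r); split.
  by apply: eq_integrable rint => // x _ /=; rewrite fineK.
move=> x ax xb; rewrite -Rintegral_itv_obnd_cbnd; last first.
  apply: (@integrableS _ _ _ _ setT) => //.
  by apply: eq_integrable rint => // y _ /=; rewrite fineK.
rewrite /Rintegral -[LHS]/(fine (h x - h a)%:E) -nu_oc// rE//; congr fine.
by apply: eq_integral => y _ /=; rewrite fineK.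
Qed.

End density.

(** * Derivatives within a segment *)

Section derive_in.
Context {R : realType}.
Implicit Types (a b x l : R) (f g : R -> R).

(** Carathéodory's criterion: the slope, completed by the value [l] at [x], is continuous there.
    This links [derive_in] to the two-sided derivative. *)
Lemma is_derive_slopeP f x l :
  is_derive x 1 f l <-> slope_in f x y @[y --> x^'] --> l.
Proof.
split=> [/is_derive1_caratheodory[s [fE sc <-]]|fl].
  apply: cvg_trans (cvg_within_filter _ sc); apply: near_eq_cvg.
  near=> y; rewrite /slope_in fE mulfK// subr_eq0.
  by near: y; exact: nbhs_dnbhs_neq.
apply/is_derive1_caratheodory.
exists (fun y => if y == x then l else slope_in f x y); rewrite eqxx; split => //.
- move=> y; case: eqVneq => [->|yx]; first by rewrite !subrr mulr0.
  by rewrite /slope_in divfK// subr_eq0.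
- apply/continuous_withinNx; rewrite eqxx; apply: cvg_trans fl.
  apply: near_eq_cvg; near=> y; rewrite ifN//.
  by near: y; exact: nbhs_dnbhs_neq.
Unshelve. all: by end_near. Qed.

(** Properness of this filter makes limits of slopes unique, which is what lets a limit be
    identified with [derive_in]. *)
Lemma within_itv_dnbhs_proper a b x : a < b -> x \in `[a, b] ->
  ProperFilter (within `[a, b]%classic x^').
Proof.
move=> ab; rewrite in_itv/= => /andP[ax xb].
split; last exact: within_filter.
move=> [e /= e0 xe].
have [y [yx xy ay yb]] : exists y, [/\ y != x, `|x - y| < e, a <= y & y <= b].
  have [xb'|bx] := ltP x b.
    exists (Num.min b (x + e / 2)).
    have : x < Num.min b (x + e / 2) by rewrite lt_min xb'/=; lra.
    have : Num.min b (x + e / 2) <= x + e / 2 by rewrite ge_min lexx orbT.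
    have : Num.min b (x + e / 2) <= b by rewrite ge_min lexx.
    move: (Num.min _ _) => y yb ye xy.
    by split=> //; [rewrite gt_eqF| rewrite ltr0_norm; lra|lra].
  exists (Num.max a (x - e / 2)).
  have : Num.max a (x - e / 2) < x by rewrite gt_max (lt_le_trans ab bx)/=; lra.
  have : x - e / 2 <= Num.max a (x - e / 2) by rewrite le_max lexx orbT.
  have : a <= Num.max a (x - e / 2) by rewrite le_max lexx.
  move: (Num.max _ _) => y ay ye xy.
  by split=> //; [rewrite lt_eqF| rewrite gtr0_norm; lra|lra].
by apply: (xe y) => //=; rewrite in_itv/= ay yb.
Qed.

Lemma cvg_derive_in a b f x l : a < b -> x \in `[a, b] ->
  slope_in f x y @[y --> within `[a, b]%classic x^'] --> l ->
  derivable_in a b f x /\ derive_in a b f x = l.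
Proof.
move=> ab xab fl; have ? := within_itv_dnbhs_proper ab xab.
by split; [apply/cvg_ex; exists l|exact: cvg_lim].
Qed.

Lemma derive_in_cvg a b f x : derivable_in a b f x ->
  slope_in f x y @[y --> within `[a, b]%classic x^'] --> derive_in a b f x.
Proof. by []. Qed.

Lemma eq_slope_in_cvg a b f g x l : {in `[a, b], f =1 g} -> x \in `[a, b] ->
  slope_in f x y @[y --> within `[a, b]%classic x^'] --> l ->
  slope_in g x y @[y --> within `[a, b]%classic x^'] --> l.
Proof.
move=> fg xab; apply: cvg_trans; apply: near_eq_cvg.
by rewrite near_withinE; near=> y => yab; rewrite /slope_in !fg.
Unshelve. all: by end_near. Qed.

Lemma is_derive_derive_in a b f x l : a < b -> x \in `[a, b] ->
  is_derive x 1 f l -> derivable_in a b f x /\ derive_in a b f x = l.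
Proof.
move=> ab xab /is_derive_slopeP fl; apply: cvg_derive_in => //.
exact: cvg_within_filter.
Qed.

Lemma within_itv_dnbhs_interior a b x : x \in `]a, b[ ->
  within `[a, b]%classic x^' = x^'.
Proof.
move=> xab; apply/seteqP; split=> P; last first.
  by move=> xP; rewrite /within; apply: filterS xP => y.
have xab' : \forall y \near x^', y \in `[a, b].
  by apply: nbhs_dnbhs; near do apply: subset_itv_oo_cc; exact: near_in_itvoo.
by rewrite /within /=; move: xab'; apply: filterS2 => y yab; exact.
Unshelve. all: by end_near. Qed.

Lemma derivable_in_is_derive a b f x : x \in `]a, b[ -> derivable_in a b f x ->
  is_derive x 1 f (derive_in a b f x).
Proof.
move=> xab fx; apply/is_derive_slopeP.
by rewrite -(within_itv_dnbhs_interior xab).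
Qed.

Lemma continuous_slope_in f h : continuous f ->
  continuous (fun x => slope_in f x (x + h)).
Proof.
move=> cf; rewrite (_ : (fun x => _) = fun x => (f (x + h) - f x) / h); last first.
  by apply/funext => x; rewrite /slope_in addrAC subrr add0r.
move=> x; apply: cvgMl; apply: cvgB; last exact: cf.
apply: (@continuous_comp _ _ _ (fun x => x + h)); last exact: cf.
by apply: cvgD; [exact: cvg_id|exact: cvg_cst].
Qed.

(* derive_in takes a junk value where the slopes diverge, so its Borel
   measurability requires the set of derivability points to be Borel.  By the
   Cauchy criterion this set is a countable intersection of countable unions of
   sets A k m, each closed as an intersection over all real increments. *)
Lemma measurable_set_slope_cvg f : continuous f ->
  measurable [set x | cvg (slope_in f x y @[y --> x^'])].
Proof.
(* [A k m] below collects the points where any two slopes with nonzero increments smaller than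
   [1 / (m + 1)] differ by at most [1 / (k + 1)]. *)
move=> cf; pose Q h x := slope_in f x (x + h).
have cQ h : continuous (Q h) by exact: continuous_slope_in.
pose A (k m : nat) : set R := \bigcap_(p in [set p : R * R |
    [/\ p.1 != 0, `|p.1| < m.+1%:R^-1, p.2 != 0 & `|p.2| < m.+1%:R^-1]])
  [set x | `|Q p.1 x - Q p.2 x| <= k.+1%:R^-1].
rewrite (_ : mkset _ = \bigcap_k \bigcup_m A k m).
  apply: bigcapT_measurable => k; apply: bigcupT_measurable => m.
  apply: closed_measurable; apply: closed_bigI => -[h h'] /= _.
  apply: (@closed_comp _ _ (fun x => `|Q h x - Q h' x|) [set y | y <= k.+1%:R^-1]).
    move=> x _; apply: cvg_norm; apply: cvgB; exact: cQ.
  exact: closed_le.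
apply/seteqP; split => x /=.
  move=> /cvg_ex[l /cvgrPdist_lt fl] k _.
  have [e /= e0 xe] := fl (k.+1%:R^-1 / 2) ltac:(by rewrite divr_gt0).
  near \oo => m; exists m => // -[h h'] /= [h0 hm h'0 h'm].
  have me : m.+1%:R^-1 < e.
    by near: m; exact: (near_infty_natSinv_lt (PosNum e0)).
  have Ql p : p != 0 -> `|p| < m.+1%:R^-1 -> `|l - Q p x| < k.+1%:R^-1 / 2.
    move=> p0 pm; apply: xe => /=.
      by rewrite opprD addNKr normrN (lt_trans pm).
    by rewrite -subr_eq0 addrAC subrr add0r.
  have := Ql _ h0 hm; have := Ql _ h'0 h'm; rewrite [in X in _ -> X -> _]distrC => lh' lh.
  rewrite -(subrK l (Q h x)) -addrA (le_trans (ler_normD _ _))//.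
  by rewrite [leRHS]splitr lerD// ltW.
move=> xA; apply: cauchy_cvg; apply: cauchy_exP => e e0.
near \oo => k; have [m _ Am] := xA k I.
have ke : k.+1%:R^-1 < e by near: k; exact: (near_infty_natSinv_lt (PosNum e0)).
have m0 : 0 < m.+1%:R^-1 / 2 :> R by rewrite divr_gt0.
exists (Q (m.+1%:R^-1 / 2) x).
exists (m.+1%:R^-1) => [/=|y /= xy yx]; first by rewrite invr_gt0.
have -> : y = x + (y - x) by rewrite addrCA subrr addr0.
rewrite -[slope_in _ _ _]/(Q (y - x) x) -ball_normE/=; apply: le_lt_trans ke.
apply: (Am (_, _)); split => /=.
- by rewrite gt_eqF.
- by rewrite gtr0_norm// gtr_pMr ?invr_gt0// invf_lt1// ltr1n.
- by rewrite subr_eq0.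
- by rewrite distrC.
Unshelve. all: by end_near. Qed.

(** The segment is cut into its endpoints, the interior points where slopes converge, and those
    where they diverge. On the second set [derive_in] is a pointwise limit of continuous slopes of
    the clamped extension; on the third it is the constant [point]. *)
Lemma measurable_derive_in a b g : a < b -> abs_continuous a b g ->
  measurable_fun `[a, b] (derive_in a b g).
Proof.
move=> ab gAC; pose f := g \o clamp a b.
have fg : {in `[a, b], f =1 g}.
  by move=> x; rewrite in_itv/= => /andP[ax xb]; rewrite /f/= clamp_id.
have cf : continuous f by apply: abs_continuous_clamp => //; exact: ltW.
pose D := [set x | cvg (slope_in f x y @[y --> x^'])].
have mD : measurable (D : set (measurableTypeR R)).
  exact: measurable_set_slope_cvg.
have gf x l : x \in `]a, b[ ->
    slope_in g x y @[y --> within `[a, b]%classic x^'] --> l <->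
    slope_in f x y @[y --> x^'] --> l.
  move=> xab; have xab' := subset_itv_oo_cc xab.
  rewrite -[X in slope_in f _ _ @[_ --> X] --> _](within_itv_dnbhs_interior xab).
  by split; apply: eq_slope_in_cvg => // y yab; rewrite fg.
rewrite -(setU1itv false) ?bnd_simp ?ltW//; apply/measurable_funU => //; split.
  exact: measurable_fun_set1.
rewrite -(setUitv1 true) ?bnd_simp//; apply/measurable_funU => //; split; last first.
  exact: measurable_fun_set1.
rewrite -(setIT `]a, b[%classic) -(setUv D) setIUr; apply/measurable_funU.
- exact: measurableI.
- by apply: measurableI => //; exact: measurableC.
split.
  apply: (@measurable_fun_cvg _ _ _ _ (fun n x => slope_in f x (x + n.+1%:R^-1))).
    move=> n; apply: measurable_funTS; apply: continuous_measurable_fun.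
    exact: continuous_slope_in.
  move=> x [xab xD].
  have /cvg_ex[l fl] : cvg (slope_in f x y @[y --> x^']) := xD.
  have [_ ->] := cvg_derive_in ab (subset_itv_oo_cc xab) ((gf _ _ xab).2 fl).
  have /cvgr_dnbhsP := fl; apply; split.
    by move=> n; rewrite -subr_eq0 addrAC subrr add0r invr_neq0.
  rewrite -[X in _ --> X]addr0; apply: cvgD; first exact: cvg_cst.
  exact: cvg_harmonic.
apply: (@eq_measurable_fun _ _ _ _ _ (cst point)); last exact: measurable_cst.
move=> x /set_mem[xab /= xD]; rewrite /derive_in dvgP// => /cvg_ex[l gl].
by apply: xD; apply/cvg_ex; exists l; apply/gf.
Qed.

End derive_in.

(** * The fundamental theorem of calculus *)

Section fundamental_theorem.
Context {R : realType}.
Implicit Types (a b : R) (f g : R -> R).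
Notation mu := (@lebesgue_measure R).

Lemma abs_continuous_density a b g : a <= b -> abs_continuous a b g ->
  exists q : R -> R, mu.-integrable [set: R] (EFin \o q) /\
    forall x, a <= x -> x <= b -> g x - g a = \int[mu]_(t in `[a, x]) q t.
Proof.
move=> ab gAC; pose V x := fine (total_variation a x g).
have VAC : abs_continuous a b V by exact: abs_continuous_total_variation.
have gBV := abs_continuous_bounded_variation ab gAC.
have fin x y : a <= x -> x <= y -> y <= b ->
    total_variation x y g \is a fin_num.
  move=> ax xy yb; apply/bounded_variationP => //.
  exact/(bounded_variationl xy yb)/(bounded_variationr ax (le_trans xy yb)).
(* This inequality makes both [V] and [V \- g] nondecreasing. *)
have VE x y : a <= x -> x <= y -> y <= b -> `|g y - g x| <= V y - V x.
  move=> ax xy yb; rewrite /V (total_variationD g ax xy).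
  rewrite fineD ?fin// ?(le_trans xy)// addrAC subrr add0r -lee_fin fineK ?fin//.
  exact: total_variation_ge.
have Vnd : {in `[a, b] &, nondecreasing_fun V}.
  move=> x y; rewrite !in_itv/= => /andP[ax _] /andP[_ yb] xy.
  by rewrite -subr_ge0 (le_trans _ (VE _ _ ax xy yb)).
have Wnd : {in `[a, b] &, nondecreasing_fun (V \- g)}.
  move=> x y; rewrite !in_itv/= => /andP[ax _] /andP[_ yb] xy.
  have := le_trans (ler_norm _) (VE _ _ ax xy yb) => /=; lra.
have [q1 [q1i q1E]] := nondecreasing_abs_continuous_density ab Vnd VAC.
have [q2 [q2i q2E]] :=
  nondecreasing_abs_continuous_density ab Wnd (abs_continuousB VAC gAC).
exists (q1 \- q2); split; first exact: (integrableB measurableT q1i q2i).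
move=> x ax xb; rewrite RintegralB//; last 2 first.
  exact: integrableS q1i.
  exact: integrableS q2i.
rewrite -q1E// -q2E//=; lra.
Qed.

Lemma ae_derive_in_density a b g (q : R -> R) : a < b ->
  mu.-integrable [set: R] (EFin \o q) ->
  (forall x, a <= x -> x <= b -> g x - g a = \int[mu]_(t in `[a, x]) q t) ->
  {ae mu, forall x, x \in `[a, b] ->
    derivable_in a b g x /\ derive_in a b g x = q x}.
Proof.
move=> ab qi qE; pose F x := \int[mu]_(t in `[a, x]) q t.
have qiS (i : interval R) : mu.-integrable [set` i] (EFin \o q).
  exact: integrableS qi.
have := @FTC1 _ q (BLeft a) (fun y => qiS (Interval (BLeft a) (BRight y)))
  (open_integrable_locally openT qi).
(* [FTC1] differentiates the indefinite integral only to the right of its base point, so the null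
   set [{a}] is discarded. *)
have : {ae mu, forall x, x != a}.
  exists [set a]; split; [exact: measurable_set1|exact: lebesgue_measure_set1|].
  by move=> x /= /negP; rewrite negbK => /eqP.
apply: (@filterS2 _ _ (ae_filter_ringOfSetsType mu)) => x xa Fx xab.
have ax : a < x by rewrite lt_neqAle eq_sym xa; move: xab; rewrite in_itv => /andP[].
have [|/derivableP] := Fx; first by rewrite /= lte_fin.
rewrite -derive1E => /[swap] -> /(is_derive_derive_in ab xab)[Fd Fq].
apply: cvg_derive_in => //; move: Fd => /derive_in_cvg; rewrite Fq.
apply: cvg_trans; apply: near_eq_cvg; rewrite near_withinE; near=> y => yab.
move: yab xab; rewrite /= !in_itv/= => /andP[ay yb] /andP[_ xb].
rewrite /slope_in; congr (_ / _).
by rewrite -qE// -qE// ?(ltW ax)//; lra.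
Unshelve. all: by end_near. Qed.

(** The derivative agrees almost everywhere with the density [q], from which integrability and the
    value of the integral transfer. Its Borel measurability does not follow from that agreement and
    comes from [measurable_derive_in]. *)
Theorem abs_continuous_FTC a b g : a < b -> abs_continuous a b g ->
  [/\ {ae mu, forall x, x \in `[a, b] -> derivable_in a b g x},
      mu.-integrable `[a, b] (EFin \o derive_in a b g) &
      \int[mu]_(x in `[a, b]) derive_in a b g x = g b - g a].
Proof.
move=> ab gAC; have [q [qi qE]] := abs_continuous_density (ltW ab) gAC.
have gq := ae_derive_in_density ab qi qE.
have mg : measurable_fun `[a, b] (EFin \o derive_in a b g).
  by apply/measurable_EFinP; apply: measurable_derive_in.
have qiab : mu.-integrable `[a, b] (EFin \o q) by exact: integrableS qi.
have mq := measurable_int _ qiab.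
have gq' : ae_eq mu `[a, b]%classic (EFin \o derive_in a b g) (EFin \o q).
  by move: gq; apply: (@filterS _ _ (ae_filter_ringOfSetsType mu)) => x xgq xab; have [_ /= ->] := xgq xab.
split.
- by move: gq; apply: (@filterS _ _ (ae_filter_ringOfSetsType mu)) => x xgq /xgq[].
- apply/integrableP; split => //; have /integrableP[_] := qiab.
  apply: le_lt_trans; rewrite le_eqVlt; apply/orP; left; apply/eqP.
  apply: ae_eq_integral => //; [exact: measurableT_comp..|].
  by move: gq'; apply: (@filterS _ _ (ae_filter_ringOfSetsType mu)) => x xgq /xgq ->.
- by rewrite qE ?lexx ?ltW// /Rintegral; congr fine; exact: ae_eq_integral.
Qed.

End fundamental_theorem.

(** * Integration by parts *)

Section quadrature.
Context {R : realType}.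
Implicit Types (a b : R) (f g h : R -> R) (p psi : {poly R}).
Notation mu := (@lebesgue_measure R).

Lemma within_continuous_bounded a b f : a <= b -> {within `[a, b], continuous f} ->
  exists2 M, 0 <= M & {in `[a, b], forall x, `|f x| <= M}.
Proof.
move=> ab cf; have cnf : {within `[a, b], continuous (fun x => `|f x|)}.
  by move=> x; apply: cvg_norm; exact: cf.
by have [c _ fc] := EVT_max ab cnf; exists `|f c|.
Qed.

Lemma abs_continuousM a b g h : a <= b ->
  abs_continuous a b g -> abs_continuous a b h ->
  abs_continuous a b (fun x => g x * h x).
Proof.
move=> ab gAC hAC.
have [M M0 gM] := within_continuous_bounded ab (abs_continuous_within gAC).
have [N N0 hN] := within_continuous_bounded ab (abs_continuous_within hAC).
apply: (abs_continuous_le2 gAC hAC N0 M0) => x y ax xy yb.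
have -> : g y * h y - g x * h x = h y * (g y - g x) + g x * (h y - h x) by ring.
rewrite (le_trans (ler_normD _ _))// !normrM lerD// ler_wpM2r//.
  by apply: hN; rewrite in_itv/= yb (le_trans ax).
by apply: gM; rewrite in_itv/= ax (le_trans xy).
Qed.

Lemma abs_continuous_horner a b p : a <= b -> abs_continuous a b (horner p).
Proof.
move=> ab; elim/poly_ind: p => [|p c ih].
  by apply: (@abs_continuous_lipschitz _ _ _ _ 0) => // x y _ _ _;
    rewrite !horner0 subrr normr0 mul0r.
have pXAC := abs_continuousM ab ih (abs_continuous_id a b).
apply: (abs_continuous_le2 pXAC pXAC ler01 (lexx 0)) => x y _ _ _.
by rewrite mul1r mul0r addr0 !hornerMXaddC opprD addrACA subrr addr0.
Qed.

Lemma derivable_in_within_continuous a b f x : x \in `[a, b] ->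
  derivable_in a b f x -> f y @[y --> within `[a, b]%classic (nbhs x)] --> f x.
Proof.
move=> xab /cvg_ex[l fl].
suff fx : f y @[y --> within `[a, b]%classic x^'] --> f x.
  apply/cvgrPdist_lt => e e0; move/cvgrPdist_lt : fx => /(_ _ e0).
  rewrite !near_withinE => fx; near=> y => yab.
  have [->|yx] := eqVneq y x; first by rewrite subrr normr0.
  by move: yx yab; near: y.
rewrite -[X in _ --> X](addr0 (f x)) -(mulr0 l) -(subrr x).
apply: (@cvg_trans _ (f x + slope_in f x y * (y - x) @[y --> within `[a, b]%classic x^'])).
  apply: near_eq_cvg; rewrite near_withinE; near=> y => _.
  rewrite /slope_in divfK; first by rewrite addrC subrK.
  rewrite subr_eq0; by near: y; exact: nbhs_dnbhs_neq.
apply: cvgD; first exact: cvg_cst.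
apply: cvgM; first exact: fl.
apply: cvgB; last exact: cvg_cst.
by apply: cvg_within_filter; apply: cvg_within_filter; exact: cvg_id.
Unshelve. all: by end_near. Qed.

Lemma derive_inM_horner a b g p x : a < b -> x \in `[a, b] ->
  derivable_in a b g x ->
  derive_in a b (fun y => g y * p.[y]) x =
    derive_in a b g x * p.[x] + g x * p^`().[x].
Proof.
move=> ab xab gx; set l := (RHS).
suff gpl : slope_in (fun y => g y * p.[y]) x y
    @[y --> within `[a, b]%classic x^'] --> l by have [] := cvg_derive_in ab xab gpl.
apply: (@cvg_trans _ (slope_in g x y * p.[y] + g x * slope_in (horner p) x y
    @[y --> within `[a, b]%classic x^'])).
  apply: near_eq_cvg; near=> y; rewrite /slope_in.
  by rewrite mulrAC mulrA -mulrDl; congr (_ / _); ring.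
apply: cvgD; apply: cvgM.
- exact: derive_in_cvg.
- by apply: cvg_within_filter; apply: cvg_within_filter; exact: continuous_horner.
- exact: cvg_cst.
- by apply: cvg_within_filter; apply/is_derive_slopeP; exact: is_derive_poly.
Unshelve. all: by end_near. Qed.

Lemma integrable_mul_horner a b (g : R -> R) p : a <= b ->
  mu.-integrable `[a, b] (EFin \o g) ->
  mu.-integrable `[a, b] (EFin \o (fun x => g x * p.[x])).
Proof.
move=> ab gi.
suff : mu.-integrable `[a, b] ((EFin \o g) \* (EFin \o horner p))%E by [].
apply: integrableMl => //.
  by apply: measurable_funTS; apply: continuous_measurable_fun; exact: continuous_horner.
have [|M M0 pM] := @within_continuous_bounded a b (horner p) ab.
  exact/continuous_subspaceT/continuous_horner.
by exists M; split; [exact: num_real|move=> N MN x xab; exact/ltW/(le_lt_trans (pM x xab))].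
Qed.

Lemma monic_quadraticP psi : monic_quadratic psi ->
  psi = 'X^2 + psi`_1 *: 'X + (psi`_0)%:P.
Proof.
move=> [/monicP psi1 psi3]; rewrite /lead_coef psi3/= in psi1.
rewrite -[LHS]coefK psi3 poly_def !big_ord_recl big_ord0/= psi1.
rewrite /bump/= expr0 expr1 scale1r alg_polyC addr0.
by rewrite addrC; congr (_ + _); exact: addrC.
Qed.

Lemma monic_quadratic_horner psi x : monic_quadratic psi ->
  psi.[x] = x ^+ 2 + psi`_1 * x + psi`_0.
Proof. by move=> /monic_quadraticP {1}->; rewrite !hornerE. Qed.

Lemma monic_quadratic_deriv2 psi : monic_quadratic psi -> psi^`()^`() = 2%:P.
Proof.
move=> /monic_quadraticP ->.
rewrite [in X in X^`()]derivD [in X in X^`()]derivD derivXn derivZ derivX derivC.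
by rewrite addr0 derivD derivMn derivX alg_polyC derivC addr0 polyCMn.
Qed.

(** One of the two integrations by parts, applied to [f] times [psi'], with [psi'' = 2]. Since [f']
    is continuous, the classical fundamental theorem suffices here. *)
Lemma integral_continuous_by_parts a b f psi : a < b -> monic_quadratic psi ->
  (forall x, x \in `[a, b] -> derivable_in a b f x) ->
  {within `[a, b], continuous (derive_in a b f)} ->
  [/\ mu.-integrable `[a, b] (EFin \o f),
      mu.-integrable `[a, b] (EFin \o derive_in a b f) &
  \int[mu]_(x in `[a, b]) (derive_in a b f x * psi^`().[x] + f x * 2) =
    f b * psi^`().[b] - f a * psi^`().[a]].
Proof.
move=> ab mq fd cg; set g := derive_in a b f.
have cf : {within `[a, b], continuous f}.
  apply/subspace_continuousP => x xab; apply: derivable_in_within_continuous => //.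
  exact: fd.
have cp p : {within `[a, b], continuous (horner p)}.
  exact/continuous_subspaceT/continuous_horner.
split; [exact/continuous_compact_integrable/cf/segment_compact|exact/continuous_compact_integrable/cg/segment_compact|].
have fpd x : x \in `]a, b[ -> is_derive x 1 (fun x => f x * psi^`().[x])
    (g x * psi^`().[x] + f x * 2).
  move=> xab; have fx := derivable_in_is_derive xab (fd _ (subset_itv_oo_cc xab)).
  apply: (is_derive_eq (is_deriveM fx (is_derive_poly psi^`() x))).
  by rewrite monic_quadratic_deriv2// hornerC /GRing.scale/= addrC mulrC.
rewrite /Rintegral (@continuous_FTC2 _ _ (fun x => f x * psi^`().[x]) _ _ ab)//=.
- move=> x; apply: cvgD; apply: cvgM; [exact: cg|exact: cp|exact: cf|exact: cvg_cst].
- have /continuous_within_itvP -/(_ ab)[_ ? ?] : {within `[a, b], continuous (fun x => f x * psi^`().[x])}.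
    by move=> x; apply: cvgM; [exact: cf|exact: cp].
  by split => // x /fpd[].
- by move=> x /fpd[Hd fpE]; rewrite derive1E fpE.
Qed.

End quadrature.

(** * The error as an integral against the second derivative *)

Section peano_kernel.
Context {R : realType}.
Implicit Types (a b : R) (f g h : R -> R) (p psi : {poly R}).
Notation mu := (@lebesgue_measure R).

Lemma ae_eq_Rintegral a b f g : measurable_fun `[a, b] f ->
  measurable_fun `[a, b] g ->
  {ae mu, forall x, x \in `[a, b] -> f x = g x} ->
  \int[mu]_(x in `[a, b]) f x = \int[mu]_(x in `[a, b]) g x.
Proof.
move=> mf mg fg; congr fine; apply: ae_eq_integral => //.
- exact/measurable_EFinP.
- exact/measurable_EFinP.
- by move: fg; apply: (@filterS _ _ (ae_filter_ringOfSetsType mu)) => x /= fg /fg ->.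
Qed.

(** The integral of [f' psi'] is eliminated between [fE], obtained from the product [f psi'], and
    [hE], obtained from the absolutely continuous product [f' psi]. *)
Lemma quad_errorE a b psi f : a < b -> monic_quadratic psi ->
  derivative_AC a b f ->
  quad_error a b psi f =
    2^-1 * \int[mu]_(x in `[a, b]) (derive2_in a b f x * psi.[x]).
Proof.
move=> ab mq [fd gAC].
have [fi gi fE] := integral_continuous_by_parts ab mq fd (abs_continuous_within gAC).
have hAC := abs_continuousM (ltW ab) gAC (abs_continuous_horner psi (ltW ab)).
have [gd g'i _] := abs_continuous_FTC ab gAC.
have [_ h'i hE] := abs_continuous_FTC ab hAC.
have g'pi := integrable_mul_horner psi (ltW ab) g'i.
have gpi := integrable_mul_horner psi^`() (ltW ab) gi.
(* The product rule for [f' psi] is available only where [f''] exists, hence almost everywhere. *)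
move: hE; rewrite (@ae_eq_Rintegral _ _ _ (fun x =>
    derive2_in a b f x * psi.[x] + derive_in a b f x * psi^`().[x])); first last.
- move: gd; apply: (@filterS _ _ (ae_filter_ringOfSetsType mu)) => x gd xab.
  by rewrite derive_inM_horner//; exact: gd.
- by apply: measurable_funD; apply/measurable_EFinP; [exact: measurable_int g'pi|exact: measurable_int gpi].
- by apply/measurable_EFinP; exact: measurable_int h'i.
rewrite RintegralD// => hE; move: fE; rewrite RintegralD//; last first.
  exact: (integrableZr _ 2 fi).
under [X in _ + X = _ -> _]eq_Rintegral do rewrite mulrC.
rewrite RintegralZl// => fE.
rewrite /quad_error; lra.
Qed.

Lemma norm1E a b g : mu.-integrable `[a, b] (EFin \o g) ->
  norm1 a b g = (\int[mu]_(x in `[a, b]) `|g x|)%:E.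
Proof.
move=> gi; rewrite /norm1 Lnorm1 /Rintegral fineK; last first.
  by apply: integrable_fin_num => //; exact: integrable_norm gi.
rewrite [RHS]integral_mkcond; apply: eq_integral => x _.
by rewrite /patch; case: ifP => //= _; rewrite normr0.
Qed.

Lemma quad_error_le a b psi f (M : R) : a < b -> monic_quadratic psi ->
  (forall x, x \in `[a, b] -> `|psi.[x]| <= M) ->
  derivative_AC a b f ->
  (`|quad_error a b psi f|%:E <= norm1 a b (derive2_in a b f) * (M / 2)%:E)%E.
Proof.
move=> ab mq psiM fAC; have [_ g'i _] := abs_continuous_FTC ab fAC.2.
rewrite quad_errorE// norm1E// -EFinM lee_fin normrM gtr0_norm ?invr_gt0//.
rewrite [leRHS]mulrA [leRHS]mulrC ler_pM2l ?invr_gt0//.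
rewrite (le_trans (le_normr_Rintegral _ _))//; first exact: integrable_mul_horner (ltW ab) g'i.
have ni : mu.-integrable `[a, b] (EFin \o (fun x => `|derive2_in a b f x|)).
  exact: integrable_norm g'i.
rewrite mulrC -RintegralZl//; apply: le_Rintegral => //.
- exact: (integrable_norm (integrable_mul_horner psi (ltW ab) g'i)).
- exact: (integrableZl _ M ni).
by move=> x xab; rewrite normrM mulrC ler_wpM2r// psiM.
Qed.

End peano_kernel.

(** * Functions with concentrated second derivative *)

Section test_functions.
Context {R : realType}.
Implicit Types (a b s t x y : R) (f g : R -> R) (psi : {poly R}).
Notation mu := (@lebesgue_measure R).

(** The slope differs from [l] by at most [K] times [|y - x|]. Such a bound holds for squared ramps
    even across their kinks, so no one-sided derivatives are needed. *)
Lemma is_derive_quadratic_remainder f x l (K : R) :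
  (\forall y \near x, `|f y - f x - l * (y - x)| <= K * `|y - x| ^+ 2) ->
  is_derive x 1 f l.
Proof.
move=> fl; apply/is_derive_slopeP/cvgrPdist_lt => e e0.
have K1 : 0 < `|K| + 1 by rewrite ltr_wpDl.
have eK : 0 < e / (`|K| + 1) by rewrite divr_gt0.
have xe : \forall y \near x, `|x - y| < e / (`|K| + 1).
  by exists (e / (`|K| + 1)).
near=> y.
have yx : y - x != 0 by rewrite subr_eq0; near: y; exact: nbhs_dnbhs_neq.
have dyx : `|y - x| < e / (`|K| + 1).
  by rewrite distrC; near: y; exact: nbhs_dnbhs.
have fly : `|f y - f x - l * (y - x)| <= K * `|y - x| ^+ 2.
  by near: y; exact: nbhs_dnbhs.
have -> : l - slope_in f x y = - (f y - f x - l * (y - x)) / (y - x).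
  by rewrite /slope_in; field.
rewrite normrM normrN normfV ltr_pdivrMr ?normr_gt0//.
apply: le_lt_trans fly _; rewrite expr2 mulrA ltr_pM2r ?normr_gt0//.
apply: le_lt_trans (_ : _ <= (`|K| + 1) * `|y - x|) _.
  by rewrite ler_wpM2r// (le_trans (ler_norm _))// lerDl.
by rewrite mulrC -ltr_pdivlMr.
Unshelve. all: by end_near. Qed.

(** The positive part of [x - s]. Half its square is the second antiderivative, vanishing to the
    left of [s], of the indicator of the half-line from [s]. *)
Definition ramp (s x : R) : R := Num.max 0 (x - s).

Lemma ramp_le s x : x <= s -> ramp s x = 0.
Proof. by move=> xs; rewrite /ramp max_l// subr_le0. Qed.

Lemma ramp_ge s x : s <= x -> ramp s x = x - s.
Proof. by move=> sx; rewrite /ramp max_r// subr_ge0. Qed.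

(** The squared ramp has the 2-Lipschitz derivative [2 * ramp s x], so its first-order Taylor
    remainder is at most the squared increment, on either side of the kink or across it. *)
Lemma ramp_sqr_remainder s x y :
  `|ramp s y ^+ 2 - ramp s x ^+ 2 - 2 * ramp s x * (y - x)| <= `|y - x| ^+ 2.
Proof.
rewrite -normrX (ger0_norm (sqr_ge0 _)) ler_norml /ramp.
have -> : y - x = (y - s) - (x - s) by ring.
move: (y - s) (x - s) => w u; have wu2 := sqr_ge0 (w - u).
have [w0|/ltW w0] := leP w 0; have [u0|/ltW u0] := leP u 0.
- by apply/andP; split; nra.
- have := mulr_ge0 u0 (_ : 0 <= - w); rewrite oppr_ge0 => /(_ w0) uw.
  by apply/andP; split; nra.
- have := mulr_ge0 w0 (_ : 0 <= - u); rewrite oppr_ge0 => /(_ u0) uw.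
  by apply/andP; split; nra.
- by apply/andP; split; nra.
Qed.

Lemma ramp_lipschitz s x y : x <= y -> `|ramp s y - ramp s x| <= y - x.
Proof.
move=> xy; have [xs|/ltW sx] := leP x s; have [ys|/ltW sy] := leP y s;
  rewrite ?(ramp_le xs) ?(ramp_le ys) ?(ramp_ge sx) ?(ramp_ge sy) ler_norml;
  apply/andP; split; lra.
Qed.

(* The witness has f'' = 1_[s, t] / (t - s), so that f' is a difference of ramps. *)
Lemma exists_uniform_second_derivative a b s t : a < b -> a <= s -> s < t -> t <= b ->
  exists f, exists r : R -> R,
  [/\ derivative_AC a b f,
      {ae mu, forall x, x \in `[a, b] -> derive2_in a b f x = r x},
      [/\ measurable_fun setT r, forall x, 0 <= r x &
        forall x, x \notin `[s, t] -> r x = 0] &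
      \int[mu]_(x in `[a, b]) r x = 1].
Proof.
move=> ab as_ st tb; have st0 : t - s != 0 by rewrite subr_eq0 gt_eqF.
have st_gt0 : 0 < (t - s)^-1 by rewrite invr_gt0 subr_gt0.
(* [F], [G] and [r] play the roles of [f], [f'] and [f'']. *)
pose F x := (ramp s x ^+ 2 - ramp t x ^+ 2) / (2 * (t - s)).
pose G x := (ramp s x - ramp t x) / (t - s).
pose r x := (t - s)^-1 * \1_(`[s, t]%classic) x.
have FG x : is_derive x 1 F (G x).
  apply: (@is_derive_quadratic_remainder _ _ _ (t - s)^-1); near=> y.
  (* Two squared-ramp remainders, each at most the squared increment, are added and halved, which
     leaves the constant [1 / (t - s)]. *)
  have -> : F y - F x - G x * (y - x) = (t - s)^-1 *
     (((ramp s y ^+ 2 - ramp s x ^+ 2 - 2 * ramp s x * (y - x)) -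
     (ramp t y ^+ 2 - ramp t x ^+ 2 - 2 * ramp t x * (y - x))) / 2).
    by rewrite /F /G; field.
  rewrite normrM gtr0_norm// ler_pM2l// normrM [`|2^-1|]gtr0_norm ?invr_gt0//.
  rewrite ler_pdivrMr// mulr_natr mulr2n (le_trans (ler_normB _ _))//.
  by rewrite lerD// ramp_sqr_remainder.
have Fab x : x \in `[a, b] -> derivable_in a b F x /\ derive_in a b F x = G x.
  by move=> xab; exact: is_derive_derive_in.
have FAC : derivative_AC a b F.
  split=> [x /Fab[]//|].
  apply: (@abs_continuous_lipschitz _ _ _ _ (2 / (t - s))) => [|x y ax xy yb].
    by rewrite divr_ge0// subr_ge0 ltW.
  have [_ ->] : derivable_in a b F y /\ derive_in a b F y = G y.
    by apply: Fab; rewrite in_itv/= yb (le_trans ax).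
  have [_ ->] : derivable_in a b F x /\ derive_in a b F x = G x.
    by apply: Fab; rewrite in_itv/= ax (le_trans xy).
  have -> : G y - G x = ((ramp s y - ramp s x) - (ramp t y - ramp t x)) / (t - s).
    by rewrite /G; field.
  rewrite normrM [`|_^-1|]gtr0_norm// mulrAC ler_pM2r//.
  by rewrite (le_trans (ler_normB _ _))// mulr_natl mulr2n lerD// ramp_lipschitz.
have F2 x : x \in `[a, b] -> x != s -> x != t -> derive2_in a b F x = r x.
  move=> xab xs xt.
  have Gr : is_derive x 1 G (r x).
    (* Away from the kinks [s] and [t], [G] is affine near [x], so its remainder is zero. *)
    apply: (@is_derive_quadratic_remainder _ _ _ 0).
    rewrite /r indicE mem_setE in_itv/=.
    have [xs'|sx] := ltP x s.
      near=> y; have ys : y < s by near: y; exact: lt_nbhsl.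
      rewrite /G !ramp_le ?(ltW xs')// ?(ltW ys)// ?(ltW (lt_trans _ st))//.
      by rewrite mul0r [X in `|X|](_ : _ = 0) ?normr0//=; field.
    have {xs}sx : s < x by rewrite lt_neqAle eq_sym xs.
    have [xt'|tx] := leP x t.
      have {xt}xt' : x < t by rewrite lt_neqAle xt.
      near=> y; have ys : s < y by near: y; exact: lt_nbhsr.
      have yt : y < t by near: y; exact: lt_nbhsl.
      rewrite /G (ramp_ge (ltW sx)) (ramp_ge (ltW ys)).
      rewrite (ramp_le (ltW xt')) (ramp_le (ltW yt)) /= mulr1 mul0r.
      by rewrite [X in `|X|](_ : _ = 0) ?normr0//; field.
    near=> y; have ys : t < y by near: y; exact: lt_nbhsr.
    rewrite /G (ramp_ge (ltW tx)) (ramp_ge (ltW ys)).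
    rewrite (ramp_ge (ltW (lt_trans st tx))) (ramp_ge (ltW (lt_trans st ys))) /=.
    by rewrite mulr0 !mul0r subr0 [X in `|X|](_ : _ = 0) ?normr0//; field.
  have [Gd <-] := is_derive_derive_in ab xab Gr.
  have GF : {in `[a, b], G =1 derive_in a b F} by move=> y /Fab[_ ->].
  by have [] := cvg_derive_in ab xab (eq_slope_in_cvg GF xab (derive_in_cvg Gd)).
have F2ae : {ae mu, forall x, x \in `[a, b] -> derive2_in a b F x = r x}.
  exists [set s; t]; split.
  - exact: measurableU.
  - by apply: countable_lebesgue_measure0; exact: finite_set_countable.
  - move=> x /= xF2; have [->|xs] := eqVneq x s; first by left.
    have [->|xt] := eqVneq x t; first by right.
    by exfalso; apply: xF2 => xab; exact: F2.
have mr : measurable_fun setT r.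
  by apply: measurable_funM => //; exact: measurable_indic.
exists F, r; split => //.
  split=> // x; first by rewrite mulr_ge0// ltW.
  by move=> xst; rewrite /r indicE mem_setE (negbTE xst) mulr0.
(* The mass of [r] is read off as [G b - G a], that is [1 - 0]. *)
have [_ _ F2int] := abs_continuous_FTC ab FAC.2.
rewrite -(ae_eq_Rintegral _ _ F2ae); last 2 first.
- by apply: measurable_derive_in => //; exact: FAC.2.
- exact: measurable_funTS.
rewrite F2int.
have [_ ->] : derivable_in a b F b /\ derive_in a b F b = G b.
  by apply: Fab; rewrite in_itv/= lexx ltW.
have [_ ->] : derivable_in a b F a /\ derive_in a b F a = G a.
  by apply: Fab; rewrite in_itv/= lexx ltW.
rewrite /G (ramp_ge tb) (ramp_ge (le_trans (ltW st) tb)) (ramp_le as_).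
by rewrite (ramp_le (le_trans as_ (ltW st))); field.
Unshelve. all: by end_near. Qed.

End test_functions.

(** * Sharpness *)

Section sharpness.
Context {R : realType}.
Implicit Types (a b x : R) (f : R -> R) (psi : {poly R}).
Notation mu := (@lebesgue_measure R).

(** A nonnegative [f''] of mass 1 supported where [psi] stays within [e] of its value at [x] has an
    integral against [psi] within [e] of that value. *)
Lemma exists_quad_error_ge a b psi x e : a < b -> monic_quadratic psi ->
  x \in `[a, b] -> 0 < e ->
  exists f, [/\ derivative_AC a b f, norm1 a b (derive2_in a b f) = 1%:E &
    (`|psi.[x]| - e) / 2 <= `|quad_error a b psi f|].
Proof.
move=> ab mq; rewrite in_itv/= => /andP[ax xb] e0.
have [d /= d0 xd] : \forall y \near x, `|psi.[x] - psi.[y]| < e.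
  have /cvgrPdist_lt := @continuous_horner _ psi x; exact.
(* The support starts at [x] and extends to the right, unless [x] is [b], where it extends to the
   left. *)
have [s [t [as_ st tb sx tx]]] :
    exists s, exists t, [/\ a <= s, s < t, t <= b, x - d < s & t < x + d].
  have [xb'|bx] := ltP x b.
    exists x, (Num.min b (x + d / 2)).
    have : x < Num.min b (x + d / 2) by rewrite lt_min xb'/=; lra.
    have : Num.min b (x + d / 2) <= x + d / 2 by rewrite ge_min lexx orbT.
    have : Num.min b (x + d / 2) <= b by rewrite ge_min lexx.
    by move: (Num.min _ _) => y; split => //; lra.
  exists (Num.max a (x - d / 2)), x.
  have : Num.max a (x - d / 2) < x by rewrite gt_max (lt_le_trans ab bx)/=; lra.
  have : x - d / 2 <= Num.max a (x - d / 2) by rewrite le_max lexx orbT.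
  have : a <= Num.max a (x - d / 2) by rewrite le_max lexx.
  by move: (Num.max _ _) => y; split => //; lra.
have [f [r [fAC fr [mr r0 r_out] r1]]] :=
  exists_uniform_second_derivative ab as_ st tb.
have [_ f2i _] := abs_continuous_FTC ab fAC.2.
have mf2 := measurable_derive_in ab fAC.2.
have mr' : measurable_fun `[a, b] r by exact: measurable_funTS.
exists f; split => //.
  rewrite norm1E//; congr EFin; rewrite -r1; apply: ae_eq_Rintegral => //.
    exact: measurableT_comp.
  move: fr; apply: (@filterS _ _ (ae_filter_ringOfSetsType mu)) => y fr yab.
  by rewrite fr// ger0_norm.
rewrite quad_errorE// normrM gtr0_norm ?invr_gt0// mulrC ler_pM2l ?invr_gt0//.
have f2pi := integrable_mul_horner psi (ltW ab) f2i.
have ri : mu.-integrable `[a, b] (EFin \o r).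
  apply/integrableP; split; first exact/measurable_EFinP.
  have /integrableP[_] := f2i; apply: le_lt_trans.
  rewrite le_eqVlt; apply/orP; left; apply/eqP; apply: ae_eq_integral => //.
  - by apply: measurableT_comp => //; exact/measurable_EFinP.
  - by apply: measurableT_comp => //; exact/measurable_EFinP.
  - move: fr; apply: (@filterS _ _ (ae_filter_ringOfSetsType mu)) => y fr /= yab.
    by rewrite -fr.
have rpi := integrable_mul_horner psi (ltW ab) ri.
rewrite (@ae_eq_Rintegral _ _ _ _ (fun y => r y * psi.[y])); first last.
- move: fr; apply: (@filterS _ _ (ae_filter_ringOfSetsType mu)) => y fr yab.
  by rewrite fr.
- by apply/measurable_EFinP; exact: measurable_int rpi.
- by apply/measurable_EFinP; exact: measurable_int f2pi.
have scaled c : \int[mu]_(y in `[a, b]) (c * r y) = c.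
  by rewrite RintegralZl// r1 mulr1.
have si c : mu.-integrable `[a, b] (EFin \o (fun y => c * r y)).
  exact: (integrableZl _ c ri).
have close y : `|psi.[x] - psi.[y]| * r y <= e * r y.
  have [yst|/r_out ->] := boolP (y \in `[s, t]); last by rewrite !mulr0.
  rewrite ler_wpM2r// ltW// xd//=; move: yst; rewrite in_itv/= => /andP[sy yt].
  by rewrite ltr_norml; apply/andP; split; lra.
have lo : psi.[x] - e <= \int[mu]_(y in `[a, b]) (r y * psi.[y]).
  rewrite -[leLHS]scaled; apply: le_Rintegral => // y _.
  have : (psi.[x] - psi.[y]) * r y <= `|psi.[x] - psi.[y]| * r y.
    by rewrite ler_wpM2r// ler_norm.
  by move=> /le_trans /(_ (close y)); lra.
have hi : \int[mu]_(y in `[a, b]) (r y * psi.[y]) <= psi.[x] + e.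
  rewrite -[leRHS]scaled; apply: le_Rintegral => // y _.
  have : (psi.[y] - psi.[x]) * r y <= `|psi.[x] - psi.[y]| * r y.
    by rewrite ler_wpM2r// distrC ler_norm.
  by move=> /le_trans /(_ (close y)); lra.
move: (\int[mu]_(y in _) _) lo hi => I lo hi.
have [p0|/ltW p0] := leP 0 psi.[x].
  by rewrite (ger0_norm p0) (le_trans lo)// ler_norm.
by rewrite (ler0_norm p0) -normrN (le_trans _ (ler_norm _))//; lra.
Qed.

Lemma K1_le a b psi (M : R) : a < b -> monic_quadratic psi ->
  (forall x, x \in `[a, b] -> `|psi.[x]| <= M) -> (K1 a b psi <= (M / 2)%:E)%E.
Proof.
move=> ab mq psiM; have M0 : 0 <= M.
  by rewrite (le_trans _ (psiM a _))// in_itv/= lexx ltW.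
apply: ge_ereal_sup => _ [f [fAC f1] <-].
apply: (le_trans (quad_error_le ab mq psiM fAC)).
by rewrite -[leRHS]mul1e lee_wpmul2r// lee_fin divr_ge0.
Qed.

Lemma K1_ge a b psi x : a < b -> monic_quadratic psi -> x \in `[a, b] ->
  ((`|psi.[x]| / 2)%:E <= K1 a b psi)%E.
Proof.
move=> ab mq xab; apply/lee_addgt0Pr => e e0.
(* The tolerance [2 * e] is halved by the factor 1/2 of the error formula. *)
have [|f [fAC f1 fe]] := @exists_quad_error_ge a b psi x (2 * e) ab mq xab.
  by rewrite mulr_gt0.
apply: (@le_trans _ _ (`|quad_error a b psi f| + e)%:E).
  by rewrite lee_fin; lra.
rewrite EFinD leeD2r//; apply: ereal_sup_ubound; exists f => //.
by split; rewrite ?f1.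
Qed.

Lemma monic_quadratic_sqr_XsubC (c m : R) :
  monic_quadratic (('X - c%:P) ^+ 2 - m%:P).
Proof.
have sz : (size (- m%:P : {poly R}) < size (('X - c%:P) ^+ 2))%N.
  by rewrite size_exp_XsubC size_polyN (leq_ltn_trans (size_polyC_leq1 _)).
split; last by rewrite size_polyDl// size_exp_XsubC.
by rewrite monicE lead_coefDl//; apply: monic_exp; exact: monicXsubC.
Qed.

Lemma monic_quadratic_equioscillation a b psi (c := (a + b) / 2) (M := (b - a) ^+ 2 / 8) :
  a < b -> monic_quadratic psi ->
  `|psi.[a]| <= M -> `|psi.[b]| <= M -> `|psi.[c]| <= M ->
  psi = ('X - c%:P) ^+ 2 - M%:P.
Proof.
move=> ab mq; rewrite !(monic_quadratic_horner _ mq) !ler_norml.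
move: (monic_quadraticP mq); move: psi`_1 psi`_0 => p q -> /andP[_ pa] /andP[_ pb] /andP[pc _].
have ba : b - a != 0 by rewrite subr_eq0 gt_eqF.
rewrite /c /M in pa pb pc.
(* The combination [psi(a) - 2 psi(c) + psi(b)] equals [4 M], while the three bounds allow at most
   [4 M]; each of them is therefore attained. *)
have sa : a ^+ 2 + p * a + q = (b - a) ^+ 2 / 8 by lra.
have sb : b ^+ 2 + p * b + q = (b - a) ^+ 2 / 8 by lra.
have pE : p = - (c + c) by apply: (mulfI ba); rewrite /c; lra.
have qE : q = c ^+ 2 - M by move: sa; rewrite pE /c /M => sa; lra.
by rewrite pE qE -mul_polyC polyCN polyCD polyCB polyC_exp; ring.
Qed.

End sharpness.

(** * The optimal monic quadratic and its quadrature formula *)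

Theorem corollary2p2 (R : realType) (a b : R) (hab : a < b) :
  let c : R := (a + b) / 2 in
  let beta : R := Num.sqrt 2 in
  let alpha : R := (b - a) / (2 * beta) in
  let phi : {poly R} := ('X - c%:P) ^+ 2 - (alpha ^+ 2)%:P in
  [/\ minimizes_K1 a b phi,
      forall psi : {poly R}, minimizes_K1 a b psi -> psi = phi,
      forall f : R -> R, derivative_AC a b f ->
        [/\ {ae @lebesgue_measure R, forall x,
               x \in `[a, b] -> derivable_in a b (derive_in a b f) x},
            (@lebesgue_measure R).-integrable `[a, b]
              (EFin \o derive2_in a b f),
            \int[@lebesgue_measure R]_(x in `[a, b]) f x
              = (b - a) / 2 * (f a + f b)
                + (b - a) ^+ 2 / 16
                  * (derive_in a b f a - derive_in a b f b)
                + quad_error a b phi f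
          & (`|quad_error a b phi f|%:E
              <= norm1 a b (derive2_in a b f) * ((b - a) ^+ 2 / 16)%:E)%E]
    & forall C : R,
        (forall f : R -> R, derivative_AC a b f ->
          (`|quad_error a b phi f|%:E
            <= norm1 a b (derive2_in a b f) * C%:E)%E) ->
        (b - a) ^+ 2 / 16 <= C].
Proof.
move=> c beta alpha phi; pose M := (b - a) ^+ 2 / 8.
have alphaE : alpha ^+ 2 = M.
  rewrite /alpha expr_div_n exprMn /beta sqr_sqrtr// /M; congr (_ / _).
  by rewrite expr2 -!natrM.
have phiE x : phi.[x] = (x - c) ^+ 2 - M by rewrite /phi alphaE !hornerE.
have mq : monic_quadratic phi by exact: monic_quadratic_sqr_XsubC.
have phiM x : x \in `[a, b] -> `|phi.[x]| <= M.
  rewrite in_itv/= => /andP[ax xb]; rewrite phiE /M /c ler_norml.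
  (* This product is [M - phi(x)], and the square in the next line is [phi(x) + M]. *)
  have xab : 0 <= (x - a) * (b - x) by rewrite mulr_ge0 ?subr_ge0.
  have c2 : 0 <= (x - (a + b) / 2) ^+ 2 by exact: sqr_ge0.
  by apply/andP; split; lra.
have aab : a \in `[a, b] by rewrite in_itv/= lexx ltW.
have bab : b \in `[a, b] by rewrite in_itv/= lexx ltW.
have cab : c \in `[a, b] by rewrite in_itv/= /c; apply/andP; split; lra.
have M16 : M / 2 = (b - a) ^+ 2 / 16 by rewrite /M; field.
have K1phi : (K1 a b phi <= (M / 2)%:E)%E by exact: K1_le.
(* Serves both minimality and uniqueness: a competitor whose constant does not exceed [M / 2] is
   [phi] itself. *)
have small psi : monic_quadratic psi -> (K1 a b psi <= (M / 2)%:E)%E -> psi = phi.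
  move=> mqpsi Kpsi; rewrite /phi alphaE.
  have le x : x \in `[a, b] -> `|psi.[x]| <= M.
    move=> xab; have := le_trans (K1_ge hab mqpsi xab) Kpsi.
    by rewrite lee_fin ler_pM2r ?invr_gt0.
  by apply: monic_quadratic_equioscillation => //; exact: le.
split.
- split=> // psi mqpsi; have [/(small _ mqpsi) -> //|/ltW] := leP (K1 a b psi) (M / 2)%:E.
  exact: le_trans.
- by move=> psi [mqpsi /(_ _ mq) psiphi]; apply: small => //; exact: le_trans K1phi.
- move=> f fAC; have [f2d f2i _] := abs_continuous_FTC hab fAC.2.
  split=> //; last first.
    by rewrite -M16; exact: quad_error_le.
  have dphi x : (phi^`()).[x] = 2 * (x - c).
    rewrite /phi derivB derivC subr0 expr2 derivM derivXsubC mul1r mulr1.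
    by rewrite hornerD hornerXsubC mulr_natl mulr2n.
  rewrite /quad_error !dphi !phiE /M /c; lra.
- move=> C fC; rewrite -M16; apply/ler_addgt0Pr => e e0.
  (* [|phi|] attains its maximum [M] at [a], so concentrating [f''] there gives norm 1 and an error
     of at least [M / 2 - e]. *)
  have [|f [fAC f1 fe]] := @exists_quad_error_ge _ a b phi a (2 * e) hab mq aab.
    by rewrite mulr_gt0.
  have := fC f fAC; rewrite f1 mul1e lee_fin => {}fC.
  have phia : `|phi.[a]| = M.
    have -> : phi.[a] = M by rewrite phiE /M /c; lra.
    by rewrite ger0_norm// divr_ge0// sqr_ge0.
  by move: fe; rewrite phia; lra.
Qed.
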